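(* Let $V$ be a complex-valued function on $[-1,1]$ extending holomorphically to a domain $D\subset\mathbb{C}$ containing $[-1,1]$, satisfying hypotheses (H1) and (H2) described in the context, and let $Y$ be a primitive of $V$. For every fixed real $a$ large enough, the equation $$\mathrm{Re}\int_{-1}^1\sqrt{V(x)-(a+ib)}\,dx=0$$ in the unknown $b\in\mathbb{R}$ has a unique solution $b=b(a)$. Moreover $$b(a)=\tfrac12\,\mathrm{Im}\,(Y(1)-Y(-1))+\mathcal{O}\!\left(\tfrac1a\right)\qquad(a\to+\infty).$$
   Context: In the integral, $\sqrt{V-(a+ib)}$ is a continuous branch on $[-1,1]$ (the equation does not depend on its sign). A turning point (for $E\in\mathbb{C}$) is a zero of $V-E$. The Stokes line starting from $x$ is $\{y:\mathrm{Re}\int_x^y(V(t)-E)^{1/2}dt=0\}$; Stokes lines are integral curves of the vector field $s(x)=i\,\overline{(V(x)-E)^{1/2}}$. (H1) For any $\Omega\subset\mathbb{C}$, if $V^{-1}(\Omega)$ is bounded then $\Omega$ is relatively compact. (H2) If $E$ is large enough with small imaginary part (i.e. there are $R_0,\varepsilon_0>0$ such that for all $E$ with $|E|\ge R_0$, $|\mathrm{Im}\,E|\le\varepsilon_0|E|$), then $1$ and $-1$ belong to the same Stokes region: there is a path from $-1$ to $1$ that does not intersect the Stokes lines issuing from the turning points. *)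

(* Defs.v *)
(* Stdlib reals with Coquelicot. *)
From Stdlib Require Import Reals List.
From Coquelicot Require Import Coquelicot.
Open Scope R_scope.

Definition segment (u v x : R) : Prop := u <= x <= v.

(** ** Topology *)

Definition set_closure {T : UniformSpace} (A : T -> Prop) (x : T) : Prop :=
  forall P : T -> Prop, locally x P -> exists y, P y /\ A y.

Definition compact_set {T : UniformSpace} (K : T -> Prop) : Prop :=
  forall (I : Type) (U : I -> T -> Prop),
    (forall i, open (U i)) ->
    (forall x, K x -> exists i, U i x) ->
    exists l : list I, forall x, K x -> exists i, In i l /\ U i x.

Definition relatively_compact {T : UniformSpace} (A : T -> Prop) : Prop :=
  compact_set (set_closure A).

Definition connected_set {T : UniformSpace} (A : T -> Prop) : Prop :=
  forall U W : T -> Prop,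
    open U -> open W ->
    (forall x, A x -> U x \/ W x) ->
    (exists x, A x /\ U x) -> (exists x, A x /\ W x) ->
    exists x, A x /\ U x /\ W x.

Definition complex_domain (D : C -> Prop) : Prop :=
  open D /\ (exists z, D z) /\ connected_set D.

Definition bounded_set (A : C -> Prop) : Prop :=
  exists M : R, forall z, A z -> Cmod z <= M.

(** ** Functions *)

Definition holomorphic_on (D : C -> Prop) (f : C -> C) : Prop :=
  forall z, D z -> ex_derive (K := C_AbsRing) (V := C_NormedModule) f z.

(** The derivative is relative to [A]: one-sided at the ends of a segment. *)
Definition is_derive_within (A : R -> Prop) (f : R -> C) (x : R) (l : C) : Prop :=
  filterdiff (K := R_AbsRing) (V := C_R_NormedModule) f
    (within A (locally x)) (fun h : R => scal h (l : C_R_NormedModule)).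

(** [Y] is a primitive of [f] on [u,v] only; the restriction to [u,v] of a holomorphic
    primitive of [f] on a neighbourhood of [u,v] is one. *)
Definition primitive_on_segment (u v : R) (f : C -> C) (Y : R -> C) : Prop :=
  forall x : R, segment u v x -> is_derive_within (segment u v) Y x (f x).

Definition CInt (f : R -> C) (u v : R) : C :=
  RInt (V := C_R_CompleteNormedModule) f u v.

(** ** Paths, parametrised by [0,1] *)

Definition is_path (D : C -> Prop) (z w : C) (g : R -> C) : Prop :=
  continuous_on (segment 0 1) g /\
  (forall t, segment 0 1 t -> D (g t)) /\
  g 0 = z /\ g 1 = w.

(** A path [g] of class C^1 with derivative [dg].  [dg] may vanish, so that
    piecewise C^1 curves can be parametrised in this way too. *)
Definition is_C1_path (D : C -> Prop) (z w : C) (g dg : R -> C) : Prop :=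
  is_path D z w g /\
  continuous_on (segment 0 1) dg /\
  (forall t, segment 0 1 t -> is_derive_within (segment 0 1) g t (dg t)).

(** [phi] is a continuous branch of [(V - E)^(1/2)] along [g] on [A]. *)
Definition sqrt_branch (V : C -> C) (E : C) (A : R -> Prop)
    (g phi : R -> C) : Prop :=
  continuous_on A phi /\
  forall t, A t -> (phi t * phi t = V (g t) - E)%C.

(** ** Stokes geometry of [V - E] in [D] *)

Definition turning_point (V : C -> C) (D : C -> Prop) (E x : C) : Prop :=
  D x /\ (V x - E)%C = 0.

(** [y] lies on a Stokes line starting from [x]: it is reached from [x] along a
    curve on which [Re (int_x^. (V - E)^(1/2) dt)] is identically 0, the
    integral and the branch of the square root being taken along that curve.
    The condition is imposed at every intermediate point because Stokes lines
    are integral curves of [i * conj ((V - E)^(1/2))], the multivalued integral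
    having no meaning without a choice of path. *)
Definition stokes_line (V : C -> C) (D : C -> Prop) (E x y : C) : Prop :=
  exists g dg phi : R -> C,
    is_C1_path D x y g dg /\
    sqrt_branch V E (segment 0 1) g phi /\
    forall s, segment 0 1 s -> Re (CInt (fun t => (phi t * dg t)%C) 0 s) = 0.

Definition same_stokes_region (V : C -> C) (D : C -> Prop) (E z w : C) : Prop :=
  exists g : R -> C,
    is_path D z w g /\
    forall x, turning_point V D E x ->
      forall t, segment 0 1 t -> ~ stokes_line V D E x (g t).

(** ** Hypotheses on [V] *)

Definition hypH1 (V : C -> C) (D : C -> Prop) : Prop :=
  forall Omega : C -> Prop,
    bounded_set (fun z => D z /\ Omega (V z)) -> relatively_compact Omega.

Definition hypH2 (V : C -> C) (D : C -> Prop) : Prop :=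
  exists R0 eps0 : R, 0 < R0 /\ 0 < eps0 /\
    forall E : C, R0 <= Cmod E -> Rabs (Im E) <= eps0 * Cmod E ->
      same_stokes_region V D E (RtoC (-1)) (RtoC 1).

(** ** The equation *)

(** For [a] large, [V - (a + ib)] has no zero on [-1,1], so that the branch
    exists and is unique up to its sign, which does not affect the equation. *)
Definition solves (V : C -> C) (a b : R) : Prop :=
  exists phi : R -> C,
    sqrt_branch V (a + Ci * b)%C (segment (-1) 1) RtoC phi /\
    Re (CInt phi (-1) 1) = 0.

(* Main.v *)
(** Write [V = p + i q] on the segment, [c = a - p] and [d = b - q].  For [a] large, [c > 0],
    so a branch of [(V - E)^(1/2)] is, up to sign, [- i w] with [w] the square root of
    [E - V = c + i d] in the right half-plane, and the equation says that the integral of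
    [Im w] vanishes.  At fixed [x], [Im w] is strictly increasing and Lipschitz in [b], and it
    has the sign of [b - q]: this gives uniqueness, and existence by the intermediate value
    theorem with [|b| <= sup |q|].  Finally [2 sqrt a * Im w = b - q + O(1/a)], and
    integrating gives the asymptotics. *)

Require Import Defs.
From Stdlib Require Import Reals Lra IndefiniteDescription.
From Coquelicot Require Import Coquelicot.
Open Scope R_scope.

(** * Continuity relative to a segment, and extension to the whole line *)

(** Nearest-point retraction of the line onto [u,v]. Composing with it turns continuity relative to
    the segment into continuity at every real point. *)
Definition clamp (u v x : R) : R := Rmax u (Rmin x v).

Lemma clamp_segment (u v x : R) : u <= v -> segment u v (clamp u v x).
Proof.
  intros Huv; unfold segment, clamp.
  split; [apply Rmax_l | apply Rmax_lub; [exact Huv | apply Rmin_r]].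
Qed.

Lemma clamp_id (u v x : R) : segment u v x -> clamp u v x = x.
Proof.
  intros [Hu Hv]; unfold clamp.
  rewrite Rmin_left by exact Hv; now apply Rmax_right.
Qed.

Lemma clamp_lipschitz (u v x y : R) :
  Rabs (clamp u v y - clamp u v x) <= Rabs (y - x).
Proof.
  unfold clamp, Rmax, Rmin.
  repeat destruct Rle_dec; unfold Rabs; repeat destruct Rcase_abs; lra.
Qed.

(** Clamping is 1-Lipschitz with values in the segment, so it maps neighbourhoods of [x] into the
    relative neighbourhoods of [clamp u v x]. *)
Lemma continuous_on_clamp {T : UniformSpace} (u v : R) (f : R -> T) :
  u <= v -> continuous_on (segment u v) f ->
  forall x : R, continuous (fun y => f (clamp u v y)) x.
Proof.
  intros Huv Hf x.
  apply (filterlim_comp _ _ _ (clamp u v) f _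
    (within (segment u v) (locally (clamp u v x)))).
  2: now apply Hf, clamp_segment.
  intros P [eps HP]; exists eps; intros y Hy.
  apply HP; [| now apply clamp_segment].
  apply Rle_lt_trans with (2 := Hy), clamp_lipschitz.
Qed.

Lemma holomorphic_continuous_on_segment (D : C -> Prop) (V : C -> C) (u v : R) :
  holomorphic_on D V -> (forall x, segment u v x -> D (RtoC x)) ->
  continuous_on (U := C_UniformSpace) (segment u v) (fun x => V (RtoC x)).
Proof.
  intros HV HD x Hx.
  intros P HP; apply filter_le_within; revert P HP.
  apply (filterlim_comp _ _ _ RtoC V _ (locally (T := C_UniformSpace) (RtoC x))).
  - intros P [eps HP]; exists eps; intros y Hy; apply HP.
    split; [exact Hy | apply (ball_center (M := R_UniformSpace))].
  - intros P HP.
    (* Complex differentiability gives continuity for the neighbourhoods defined by the modulus;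
       [locally_C] identifies them with those of the product structure. *)
    apply (locally_C (RtoC x) (fun z => P (V z))).
    apply (ex_derive_continuous (K := C_AbsRing) (V := C_NormedModule) V (RtoC x)).
    + apply HV, HD, Hx.
    + exact HP.
Qed.

Lemma continuous_on_comp {T U W : UniformSpace} (A : T -> Prop) (f : T -> U) (g : U -> W) :
  continuous_on A f -> (forall y, continuous g y) ->
  continuous_on A (fun x => g (f x)).
Proof. intros Hf Hg x Hx; exact (filterlim_comp _ _ _ f g _ _ _ (Hf x Hx) (Hg (f x))). Qed.

Lemma continuous_Re (z : C) : continuous (T := C_UniformSpace) Re z.
Proof. destruct z as [x y]; exact (continuous_fst x y). Qed.

Lemma continuous_Im (z : C) : continuous (T := C_UniformSpace) Im z.
Proof. destruct z as [x y]; exact (continuous_snd x y). Qed.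

Lemma continuous_Cpair (f g : R -> R) (x : R) :
  continuous f x -> continuous g x ->
  continuous (U := C_UniformSpace) (fun y => (f y, g y)) x.
Proof.
  intros Hf Hg.
  apply (continuous_comp_2 (X := C_UniformSpace) f g (fun y z => (y, z)) x Hf Hg).
  apply (continuous_ext (T := C_UniformSpace) (fun z => z)).
  - apply surjective_pairing.
  - apply (continuous_id (U := C_UniformSpace)).
Qed.

(** * Real parts of complex integrals, and primitives on a segment *)

Lemma is_RInt_Re_CInt (f : R -> C) (u v : R) :
  u <= v -> continuous_on (segment u v) f ->
  is_RInt (fun x => Re (f x)) u v (Re (CInt f u v)).
Proof.
  intros Huv Hf.
  apply (is_RInt_fct_extend_fst (U := R_NormedModule) (V := R_NormedModule) f u v (CInt f u v)).
  apply (RInt_correct (V := C_R_CompleteNormedModule)).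
  apply ex_RInt_ext with (fun x => f (clamp u v x)).
  - rewrite Rmin_left, Rmax_right by exact Huv; intros x Hx.
    rewrite clamp_id; [reflexivity | split; lra].
  - apply (ex_RInt_continuous (V := C_R_CompleteNormedModule)); intros x _.
    apply (continuous_on_clamp (T := C_UniformSpace) u v f Huv Hf x).
Qed.

(** [Y] has only one-sided derivatives at the ends, so the mean value theorem is applied to the
    difference of [Im Y] and the integral of [q]: it is continuous up to the ends, with zero
    derivative inside. *)
Lemma RInt_Im_primitive (u v : R) (f : C -> C) (Y : R -> C) (q : R -> R) :
  u <= v -> (forall x, continuous q x) ->
  (forall x, segment u v x -> q x = Im (f (RtoC x))) ->
  primitive_on_segment u v f Y ->
  RInt q u v = Im (Y v) - Im (Y u).
Proof.
  intros Huv Hq Hqf HY.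
  assert (HIm : forall x, segment u v x ->
    filterdiff (fun y => Im (Y y)) (within (segment u v) (locally x))
      (fun h => scal h (q x))).
  { intros x Hx.
    apply filterdiff_ext_lin with (fun h : R => snd (scal h (f (RtoC x) : C_R_NormedModule))).
    2: intros h; rewrite Hqf by exact Hx; reflexivity.
    apply (filterdiff_comp (U := R_NormedModule) (V := C_R_NormedModule) (W := R_NormedModule) Y snd _ snd).
    - apply HY, Hx.
    - apply filterdiff_linear, is_linear_snd. }
  assert (Hc : continuous_on (segment u v) (fun y => Im (Y y))).
  { intros x Hx.
    apply (filterdiff_continuous_aux (K := R_AbsRing) (U := R_NormedModule)
      (V := R_NormedModule) (F := within (segment u v) (locally x)) (fun y => Im (Y y))).
    - eexists; now apply HIm.
    - intros P HP; now apply filter_le_within. }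
  assert (HI : forall x, is_derive (RInt q u) x (q x)).
  { intros x; apply (is_derive_RInt q (RInt q u) u); [| apply Hq].
    apply filter_forall; intros y; apply (RInt_correct (V := R_CompleteNormedModule)).
    apply (ex_RInt_continuous (V := R_CompleteNormedModule)); intros; apply Hq. }
  destruct (MVT_gen (fun x => Im (Y (clamp u v x)) - RInt q u x) u v (fun _ => 0))
    as [c [_ Hc0]].
  - rewrite Rmin_left, Rmax_right by exact Huv; intros x Hx.
    replace 0 with (q x - q x) by ring.
    apply (is_derive_minus (K := R_AbsRing) (V := R_NormedModule)); [| apply HI].
    assert (Hloc : locally x (segment u v)).
    { apply (locally_interval _ x u v); [apply Hx | apply Hx |].
      intros y H1 H2; split; apply Rlt_le; assumption. }
    apply is_derive_ext_loc with (fun y => Im (Y y)).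
    { revert Hloc; apply filter_imp; intros y Hy; now rewrite clamp_id. }
    (* At an interior point the segment is a neighbourhood, so the relative differential is an
       ordinary one. *)
    destruct (HIm x) as [Hlin Hdom]; [split; lra |].
    split; [exact Hlin |].
    intros y Hy eps.
    assert (H : within (segment u v) (locally x) (fun z =>
      norm (minus (minus (Im (Y z)) (Im (Y y))) (scal (minus z y) (q x)))
        <= eps * norm (minus z y))).
    { apply (Hdom y); intros P HP; apply filter_le_within, Hy, HP. }
    generalize (filter_and _ _ Hloc H).
    apply filter_imp; intros z [Hz1 Hz2]; now apply Hz2.
  - intros x _; apply continuity_pt_filterlim.
    apply (continuous_minus (V := R_NormedModule) (fun y => Im (Y (clamp u v y))) (RInt q u)).
    + apply (continuous_on_clamp u v (fun y => Im (Y y)) Huv Hc).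
    + apply (ex_derive_continuous (K := R_AbsRing) (V := R_NormedModule) (RInt q u) x).
      exists (q x); apply HI.
  - rewrite !clamp_id, RInt_point in Hc0 by (split; lra).
    change (@zero R_CompleteNormedModule) with 0 in Hc0.
    lra.
Qed.

(** * The square root in the right half-plane *)

(** [csqrt_re c d + i csqrt_im c d] is the square root of [c + i d] in the right half-plane
    when [0 < c]. *)
Definition csqrt_re (c d : R) : R := sqrt ((c + sqrt (c * c + d * d)) / 2).

Definition csqrt_im (c d : R) : R := d / (2 * csqrt_re c d).

Lemma csqrt_arg_ge (c d : R) : c <= (c + sqrt (c * c + d * d)) / 2.
Proof.
  assert (Rabs c <= sqrt (c * c + d * d)).
  { rewrite <- sqrt_Rsqr_abs; apply sqrt_le_1_alt; unfold Rsqr; nra. }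
  generalize (Rle_abs c); lra.
Qed.

Lemma csqrt_re_ge (c d : R) : sqrt c <= csqrt_re c d.
Proof. apply sqrt_le_1_alt, csqrt_arg_ge. Qed.

Lemma csqrt_re_pos (c d : R) : 0 < c -> 0 < csqrt_re c d.
Proof.
  intros Hc; apply Rlt_le_trans with (2 := csqrt_re_ge c d).
  now apply sqrt_lt_R0.
Qed.

Lemma csqrt_prod (c d : R) : 0 < c -> 2 * csqrt_re c d * csqrt_im c d = d.
Proof.
  intros Hc; generalize (csqrt_re_pos c d Hc); intros.
  unfold csqrt_im; field; lra.
Qed.

Lemma csqrt_sqr (c d : R) :
  0 < c -> csqrt_re c d * csqrt_re c d - csqrt_im c d * csqrt_im c d = c.
Proof.
  intros Hc.
  assert (Hu := csqrt_re_pos c d Hc).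
  assert (Huu : csqrt_re c d * csqrt_re c d = (c + sqrt (c * c + d * d)) / 2).
  { apply sqrt_sqrt; generalize (csqrt_arg_ge c d); lra. }
  assert (Hs : sqrt (c * c + d * d) * sqrt (c * c + d * d) = c * c + d * d).
  { apply sqrt_sqrt; nra. }
  assert (Hd := csqrt_prod c d Hc).
  set (u := csqrt_re c d) in *; set (v := csqrt_im c d) in *.
  set (s := sqrt (c * c + d * d)) in *.
  assert (Huv : 4 * (u * u) * (v * v) = d * d) by (rewrite <- Hd; ring).
  (* After multiplication by 4u², the claim is (c + s)² - d² = 2c(c + s), which follows from s² = c²
     + d². *)
  apply Rmult_eq_reg_l with (4 * (u * u)); [| nra].
  rewrite Rmult_minus_distr_l, Huv, Huu; nra.
Qed.

(** With [w_i = u_i + i v_i] this is the imaginary part of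
    [w1 - w2 = (w1^2 - w2^2) / (w1 + w2)], cleared of its denominator. *)
Lemma square_root_diff (c d1 d2 u1 u2 v1 v2 : R) :
  u1 * u1 - v1 * v1 = c -> u2 * u2 - v2 * v2 = c ->
  2 * u1 * v1 = d1 -> 2 * u2 * v2 = d2 ->
  (v1 - v2) * ((u1 + u2) * (u1 + u2) + (v1 + v2) * (v1 + v2)) = (d1 - d2) * (u1 + u2).
Proof.
  intros H1 H2 <- <-.
  assert (H : u1 * u1 - u2 * u2 = v1 * v1 - v2 * v2) by lra.
  replace ((v1 - v2) * ((u1 + u2) * (u1 + u2) + (v1 + v2) * (v1 + v2)))
    with ((v1 - v2) * ((u1 + u2) * (u1 + u2)) + (v1 * v1 - v2 * v2) * (v1 + v2)) by ring.
  rewrite <- H; ring.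
Qed.

Lemma csqrt_im_diff (c d1 d2 : R) : 0 < c ->
  (csqrt_im c d1 - csqrt_im c d2) *
    ((csqrt_re c d1 + csqrt_re c d2) * (csqrt_re c d1 + csqrt_re c d2) +
     (csqrt_im c d1 + csqrt_im c d2) * (csqrt_im c d1 + csqrt_im c d2)) =
  (d1 - d2) * (csqrt_re c d1 + csqrt_re c d2).
Proof.
  intros Hc; apply square_root_diff with c; now (apply csqrt_sqr || apply csqrt_prod).
Qed.

(** In [csqrt_im_diff] the sum of squares is nonnegative and the sum of real parts positive, so the
    two differences have the same sign. *)
Lemma csqrt_im_increasing (c d1 d2 : R) :
  0 < c -> d1 < d2 -> csqrt_im c d1 < csqrt_im c d2.
Proof.
  intros Hc Hd.
  assert (H := csqrt_im_diff c d1 d2 Hc).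
  assert (H1 := csqrt_re_pos c d1 Hc); assert (H2 := csqrt_re_pos c d2 Hc).
  apply Rnot_le_lt; intros Hle.
  assert (0 <= (csqrt_im c d1 - csqrt_im c d2) *
    ((csqrt_re c d1 + csqrt_re c d2) * (csqrt_re c d1 + csqrt_re c d2) +
     (csqrt_im c d1 + csqrt_im c d2) * (csqrt_im c d1 + csqrt_im c d2))).
  { apply Rmult_le_pos; [lra |]. apply Rplus_le_le_0_compat; apply Rle_0_sqr. }
  nra.
Qed.

(** For c >= 1 the sum S of the real parts is at least 2, so S² + W² >= S, and S cancels in
    [csqrt_im_diff]. *)
Lemma csqrt_im_lipschitz (c d1 d2 : R) :
  1 <= c -> Rabs (csqrt_im c d1 - csqrt_im c d2) <= Rabs (d1 - d2).
Proof.
  intros Hc.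
  assert (H := csqrt_im_diff c d1 d2 ltac:(lra)).
  assert (Hs : 1 <= sqrt c) by (rewrite <- sqrt_1; now apply sqrt_le_1_alt).
  assert (H1 := csqrt_re_ge c d1); assert (H2 := csqrt_re_ge c d2).
  set (S := csqrt_re c d1 + csqrt_re c d2) in *.
  set (W := csqrt_im c d1 + csqrt_im c d2) in *.
  assert (HS : 2 <= S) by (unfold S; lra).
  apply (f_equal Rabs) in H.
  rewrite !Rabs_mult, (Rabs_pos_eq (S * S + W * W)), (Rabs_pos_eq S) in H by nra.
  assert (HX := Rabs_pos (csqrt_im c d1 - csqrt_im c d2)).
  apply Rmult_le_reg_r with S; [lra |].
  rewrite <- H; apply Rmult_le_compat_l; [exact HX | nra].
Qed.

(** In [square_root_diff] with equal [d] the right side vanishes, while the sum of squares is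
    positive because both real parts are. *)
Lemma csqrt_unique (c d u v : R) :
  0 < c -> 0 < u -> u * u - v * v = c -> 2 * u * v = d -> v = csqrt_im c d.
Proof.
  intros Hc Hu H1 H2.
  assert (H := square_root_diff c d d u (csqrt_re c d) v (csqrt_im c d)
    H1 (csqrt_sqr c d Hc) H2 (csqrt_prod c d Hc)).
  rewrite Rminus_diag, Rmult_0_l in H.
  assert (Hr := csqrt_re_pos c d Hc).
  apply Rmult_integral in H; destruct H as [H | H]; [lra |].
  generalize (Rle_0_sqr (v + csqrt_im c d)); unfold Rsqr; nra.
Qed.

Lemma continuous_csqrt_re (c d : R -> R) (x : R) :
  continuous c x -> continuous d x -> continuous (fun y => csqrt_re (c y) (d y)) x.
Proof.
  intros Hc Hd; unfold csqrt_re.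
  apply continuous_sqrt_comp.
  apply (continuous_scal_l (V := R_NormedModule) (fun y => c y + sqrt (c y * c y + d y * d y)) (/ 2)).
  apply (continuous_plus (V := R_NormedModule)); [exact Hc |].
  apply continuous_sqrt_comp.
  apply (continuous_plus (V := R_NormedModule));
    now apply (continuous_mult (K := R_AbsRing)).
Qed.

Lemma continuous_csqrt_im (c d : R -> R) (x : R) :
  0 < c x -> continuous c x -> continuous d x ->
  continuous (fun y => csqrt_im (c y) (d y)) x.
Proof.
  intros Hpos Hc Hd; unfold csqrt_im.
  apply (continuous_mult (K := R_AbsRing)); [exact Hd |].
  apply continuous_Rinv_comp.
  - apply (continuous_scal_r (V := R_NormedModule) 2).
    now apply continuous_csqrt_re.
  - generalize (csqrt_re_pos (c x) (d x) Hpos); lra.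
Qed.

(** [csqrt_re^2 - a = (c - a) + csqrt_im^2] is bounded, so [csqrt_re] is [sqrt a] up to
    [O(1 / sqrt a)]. *)
Lemma csqrt_im_asymptotic (M a c d : R) :
  0 <= M -> 1 <= c -> a <= 4 * c -> 0 < a -> Rabs (a - c) <= M -> Rabs d <= 2 * M ->
  Rabs (2 * sqrt a * csqrt_im c d - d) <= 4 * M * (M + M * M) / a.
Proof.
  intros HM Hc Hac Ha HcM HdM.
  assert (Hr := csqrt_re_pos c d ltac:(lra)).
  assert (Hp := csqrt_prod c d ltac:(lra)).
  assert (Hq := csqrt_sqr c d ltac:(lra)).
  assert (Hsa := sqrt_lt_R0 a Ha).
  assert (Hs := sqrt_sqrt a ltac:(lra)).
  set (u := csqrt_re c d) in *; set (v := csqrt_im c d) in *; set (s := sqrt a) in *.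
  assert (Huc : c <= u * u) by nra.
  (* This comes from s² = a <= 4c <= 4u². *)
  assert (Hus : s <= 2 * u) by (apply Rsqr_incr_0; unfold Rsqr; nra).
  assert (Hvv : v * v <= M * M).
  { assert (Hdd : d * d <= 4 * (M * M)).
    { apply Rabs_le_between in HdM; nra. }
    assert (4 * (u * u) * (v * v) = d * d) by (rewrite <- Hp; ring).
    nra. }
  assert (Hu2 : Rabs (u * u - a) <= M + M * M).
  { apply Rabs_le_between in HcM; apply Rabs_le_between; nra. }
  assert (Hsu : Rabs (s - u) * s <= M + M * M).
  { apply Rle_trans with (2 := Hu2).
    replace (u * u - a) with ((u - s) * (u + s)) by (rewrite <- Hs; ring).
    rewrite Rabs_mult, Rabs_minus_sym, (Rabs_pos_eq (u + s)) by lra.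
    apply Rmult_le_compat_l; [apply Rabs_pos | lra]. }
  (* Since d = 2uv, the error is 2v(s - u) = d(s - u)/u. *)
  replace (2 * s * v - d) with (d * (s - u) / u) by (rewrite <- Hp; field; lra).
  unfold Rdiv; rewrite !Rabs_mult, (Rabs_pos_eq (/ u))
    by (apply Rlt_le, Rinv_0_lt_compat; lra).
  (* With a = s², clearing denominators leaves three factors to compare: |d| <= 2M, |s - u| s <= M +
     M² and s <= 2u. *)
  apply Rmult_le_reg_r with (u * a); [nra |].
  replace (Rabs d * Rabs (s - u) * / u * (u * a)) with (Rabs d * (Rabs (s - u) * s) * s)
    by (rewrite <- Hs; field; lra).
  replace (4 * M * (M + M * M) * / a * (u * a)) with (2 * M * (M + M * M) * (2 * u))
    by (field; lra).
  assert (HX := Rabs_pos d); assert (HZ := Rabs_pos (s - u)).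
  apply Rmult_le_compat; [| lra | | lra].
  - apply Rmult_le_pos; nra.
  - apply Rmult_le_compat; nra.
Qed.

(** * Signs and bounds of continuous functions on a segment *)

(** A change of sign between [u] and [x] would give a zero by the intermediate value theorem.
    Applied to [Im phi], this fixes the sign of a branch on the whole segment. *)
Lemma nonvanishing_sign (u v : R) (f : R -> R) :
  u <= v -> continuous_on (segment u v) f -> (forall x, segment u v x -> f x <> 0) ->
  (forall x, segment u v x -> 0 < f x) \/ (forall x, segment u v x -> f x < 0).
Proof.
  intros Huv Hf Hnz.
  assert (Hc := continuous_on_clamp u v f Huv Hf).
  assert (Hu : segment u v u) by (split; lra).
  assert (Hsame : forall x, segment u v x ->
    ~ (Rmin (f u) (f x) <= 0 <= Rmax (f u) (f x))).
  { intros x Hx H0.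
    destruct (IVT_gen_consistent (fun y => f (clamp u v y)) u x 0 Hc) as [z [_ Hz]].
    - now rewrite !clamp_id.
    - now apply (Hnz (clamp u v z)); [apply clamp_segment |]. }
  destruct (Rlt_or_le 0 (f u)) as [Hpos | Hneg]; [left | right];
    intros x Hx; apply Rnot_le_lt; intros Hle; apply (Hsame x Hx);
    unfold Rmin, Rmax; repeat destruct Rle_dec; lra.
Qed.

Lemma continuous_bounded_on_segment (u v : R) (f : R -> R) :
  u <= v -> (forall x, continuous f x) ->
  exists M, 0 <= M /\ forall x, segment u v x -> Rabs (f x) <= M.
Proof.
  intros Huv Hf.
  destruct (continuity_ab_maj (fun x => Rabs (f x)) u v Huv) as [m [Hm _]].
  - intros x _; apply continuity_pt_filterlim, continuous_Rabs_comp, Hf.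
  - exists (Rabs (f m)); split; [apply Rabs_pos | exact Hm].
Qed.

(** * The equation in [b] at fixed [a]: reformulation, solution, asymptotics *)

Section Equation.

Variables (V : C -> C) (p q : R -> R) (M : R).
Hypothesis Hp : forall x, continuous p x.
Hypothesis Hq : forall x, continuous q x.
Hypothesis Hpq : forall x, segment (-1) 1 x -> V (RtoC x) = (p x, q x).
Hypothesis HM : 0 <= M.
Hypothesis HpM : forall x, segment (-1) 1 x -> Rabs (p x) <= M.
Hypothesis HqM : forall x, segment (-1) 1 x -> Rabs (q x) <= M.

Definition root_im_integral (a b : R) : R :=
  RInt (fun x => csqrt_im (a - p x) (b - q x)) (-1) 1.

(** Since M <= (a - 1)/2, the gap is in fact at least (a + 1)/2, whence also the condition
    [a <= 4 * c] of [csqrt_im_asymptotic]. *)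
Lemma gap_ge_1 (a x : R) : 2 * M + 1 <= a -> segment (-1) 1 x -> 1 <= a - p x.
Proof. intros Ha Hx; generalize (proj1 (Rabs_le_between _ _) (HpM x Hx)); lra. Qed.

Lemma continuous_gap (r : R -> R) (a x : R) :
  continuous r x -> continuous (fun y => a - r y) x.
Proof.
  intros Hr; apply (continuous_minus (V := R_NormedModule) (fun _ => a) r).
  - apply continuous_const.
  - exact Hr.
Qed.

Lemma continuous_root_im (a b x : R) :
  2 * M + 1 <= a -> segment (-1) 1 x ->
  continuous (fun y => csqrt_im (a - p y) (b - q y)) x.
Proof.
  intros Ha Hx; apply continuous_csqrt_im.
  - generalize (gap_ge_1 a x Ha Hx); lra.
  - apply continuous_gap, Hp.
  - apply continuous_gap, Hq.
Qed.

Lemma ex_RInt_root_im (a b : R) :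
  2 * M + 1 <= a -> ex_RInt (fun x => csqrt_im (a - p x) (b - q x)) (-1) 1.
Proof.
  intros Ha; apply (ex_RInt_continuous (V := R_CompleteNormedModule)).
  rewrite Rmin_left, Rmax_right by lra; intros x Hx.
  now apply continuous_root_im.
Qed.

(** The number -i [phi] is a square root of E - V, with real part [Im phi] and imaginary part
    [- Re phi]. *)
Lemma sqrt_branch_parts (a b : R) (phi : R -> C) (x : R) :
  segment (-1) 1 x ->
  (phi x * phi x)%C = (V (RtoC x) - (a + Ci * b))%C <->
  Im (phi x) * Im (phi x) - Re (phi x) * Re (phi x) = a - p x /\
  2 * Im (phi x) * Re (phi x) = - (b - q x).
Proof.
  intros Hx; rewrite Hpq by exact Hx.
  destruct (phi x) as [s t]; unfold Re, Im; simpl.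
  unfold Cmult, Cminus, Cplus, Copp, RtoC, Ci; simpl.
  split.
  - intros H; injection H as H1 H2; lra.
  - intros [H1 H2]; f_equal; lra.
Qed.

Lemma solves_iff (a b : R) :
  2 * M + 1 <= a -> solves V a b <-> root_im_integral a b = 0.
Proof.
  intros Ha; split.
  - intros [phi [[Hphi Hsq] Hint]].
    assert (HI := is_RInt_Re_CInt phi (-1) 1 ltac:(lra) Hphi); rewrite Hint in HI.
    assert (Hparts : forall x, segment (-1) 1 x ->
      Im (phi x) * Im (phi x) - Re (phi x) * Re (phi x) = a - p x /\
      2 * Im (phi x) * Re (phi x) = - (b - q x)).
    { intros x Hx; apply sqrt_branch_parts, Hsq; exact Hx. }
    destruct (nonvanishing_sign (-1) 1 (fun x => Im (phi x))) as [Hs | Hs].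
    + lra.
    + apply (continuous_on_comp (U := C_UniformSpace)); [exact Hphi | apply continuous_Im].
    (* If [Im phi] vanished, then -(Re phi)² would be a - p >= 1. *)
    + intros x Hx H0; destruct (Hparts x Hx) as [H1 _].
      generalize (gap_ge_1 a x Ha Hx); rewrite H0 in H1; nra.
    (* For [Im phi] > 0 the right half-plane root is -i [phi], so [csqrt_im] is [- Re phi]; in the
       other case the root is i [phi] and the sign disappears. *)
    + apply is_RInt_unique; rewrite <- Ropp_0.
      apply is_RInt_ext with (fun x => - Re (phi x));
        [| exact (is_RInt_opp (V := R_NormedModule) _ _ _ _ HI)].
      rewrite Rmin_left, Rmax_right by lra; intros x Hx.
      assert (Hx' : segment (-1) 1 x) by (split; lra).
      destruct (Hparts x Hx') as [H1 H2].
      generalize (gap_ge_1 a x Ha Hx') (Hs x Hx'); intros.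
      apply csqrt_unique with (Im (phi x)); lra.
    + apply is_RInt_unique.
      apply is_RInt_ext with (2 := HI).
      rewrite Rmin_left, Rmax_right by lra; intros x Hx.
      assert (Hx' : segment (-1) 1 x) by (split; lra).
      destruct (Hparts x Hx') as [H1 H2].
      generalize (gap_ge_1 a x Ha Hx') (Hs x Hx'); intros.
      apply csqrt_unique with (- Im (phi x)); lra.
  - intros HG.
    (* This is -i w, with w the right half-plane root. *)
    set (phi := fun x => (csqrt_im (a - p x) (b - q x), - csqrt_re (a - p x) (b - q x)) : C).
    assert (Hphi : continuous_on (U := C_UniformSpace) (segment (-1) 1) phi).
    { apply continuous_on_forall; intros x Hx.
      apply continuous_Cpair.
      - now apply continuous_root_im.
      - apply (continuous_opp (V := R_NormedModule)).
        apply continuous_csqrt_re; apply continuous_gap; [apply Hp | apply Hq]. }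
    exists phi; split; [split |].
    + exact Hphi.
    + intros x Hx; apply sqrt_branch_parts; [exact Hx |].
      assert (Hc := gap_ge_1 a x Ha Hx).
      generalize (csqrt_sqr (a - p x) (b - q x) ltac:(lra))
        (csqrt_prod (a - p x) (b - q x) ltac:(lra)).
      unfold phi, Re, Im; simpl; lra.
    + rewrite <- HG; symmetry; apply is_RInt_unique.
      apply (is_RInt_Re_CInt phi); [lra | exact Hphi].
Qed.

Lemma root_im_integral_increasing (a b1 b2 : R) :
  2 * M + 1 <= a -> b1 < b2 -> root_im_integral a b1 < root_im_integral a b2.
Proof.
  intros Ha Hb; apply RInt_lt; [lra | | |]; intros x Hx.
  - now apply continuous_root_im.
  - now apply continuous_root_im.
  - apply csqrt_im_increasing; [| lra].
    generalize (gap_ge_1 a x Ha ltac:(split; lra)); lra.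
Qed.

Lemma continuous_root_im_integral (a b : R) :
  2 * M + 1 <= a -> continuous (root_im_integral a) b.
Proof.
  intros Ha; apply filterlim_locally; intros eps.
  (* The integrand is 1-Lipschitz in [b] and the interval has length 2. *)
  exists (pos_div_2 eps); intros b' Hb.
  change (Rabs (b' - b) < eps / 2) in Hb.
  change (Rabs (root_im_integral a b' - root_im_integral a b) < eps).
  unfold root_im_integral.
  rewrite <- (RInt_minus (V := R_CompleteNormedModule)) by now apply ex_RInt_root_im.
  apply Rle_lt_trans with ((1 - -1) * Rabs (b' - b)); [| lra].
  apply abs_RInt_le_const; [lra | |].
  - apply (ex_RInt_minus (V := R_NormedModule)); now apply ex_RInt_root_im.
  - intros x Hx.
    replace (b' - b) with ((b' - q x) - (b - q x)) by ring.
    now apply csqrt_im_lipschitz, gap_ge_1.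
Qed.

(** The bound on [b] is recorded because it gives |b - q| <= 2M, as the asymptotics require. *)
Lemma root_im_integral_zero (a : R) :
  2 * M + 1 <= a -> exists b, Rabs b <= M /\ root_im_integral a b = 0.
Proof.
  intros Ha.
  assert (Hsign : forall c, csqrt_im c 0 = 0) by (intros; unfold csqrt_im, Rdiv; ring).
  assert (Hcst : forall x, segment (-1) 1 x -> 0 < a - p x)
    by (intros x Hx; generalize (gap_ge_1 a x Ha Hx); lra).
  assert (Hmono : forall c d1 d2, 0 < c -> d1 <= d2 -> csqrt_im c d1 <= csqrt_im c d2).
  { intros c d1 d2 Hc [Hd | ->]; [| lra].
    now apply Rlt_le, csqrt_im_increasing. }
  assert (Hz : RInt (fun _ : R => 0) (-1) 1 = 0)
    by (rewrite (RInt_const (V := R_CompleteNormedModule)); apply Rmult_0_r).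
  assert (Hlo : root_im_integral a (- M) <= 0).
  { rewrite <- Hz; apply RInt_le; [lra | now apply ex_RInt_root_im | apply ex_RInt_const |].
    intros x Hx; assert (Hx' : segment (-1) 1 x) by (split; lra).
    rewrite <- (Hsign (a - p x)); apply Hmono; [now apply Hcst |].
    generalize (proj1 (Rabs_le_between _ _) (HqM x Hx')); lra. }
  assert (Hhi : 0 <= root_im_integral a M).
  { rewrite <- Hz; apply RInt_le; [lra | apply ex_RInt_const | now apply ex_RInt_root_im |].
    intros x Hx; assert (Hx' : segment (-1) 1 x) by (split; lra).
    rewrite <- (Hsign (a - p x)); apply Hmono; [now apply Hcst |].
    generalize (proj1 (Rabs_le_between _ _) (HqM x Hx')); lra. }
  destruct (IVT_gen_consistent (root_im_integral a) (- M) M 0) as [b [Hb H0]].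
  - intros b; now apply continuous_root_im_integral.
  - rewrite Rmin_left, Rmax_right; lra.
  - exists b; split; [| exact H0].
    rewrite Rmin_left, Rmax_right in Hb by lra; now apply Rabs_le_between.
Qed.

Lemma root_im_integral_zero_asymptotic (a b : R) :
  2 * M + 1 <= a -> Rabs b <= M -> root_im_integral a b = 0 ->
  Rabs (b - / 2 * RInt q (-1) 1) <= 4 * M * (M + M * M) / a.
Proof.
  intros Ha Hb H0.
  assert (HIq : ex_RInt q (-1) 1)
    by (apply (ex_RInt_continuous (V := R_CompleteNormedModule)); intros; apply Hq).
  assert (HIbq : is_RInt (fun x => b - q x) (-1) 1 (2 * b - RInt q (-1) 1)).
  { apply (is_RInt_minus (V := R_NormedModule) (fun _ => b) q).
    - replace (2 * b) with ((1 - -1) * b) by ring.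
      apply (is_RInt_const (V := R_NormedModule)).
    - now apply (RInt_correct (V := R_CompleteNormedModule)). }
  (* The root term integrates to 0, so this integral is -2 times the quantity to estimate; the
     factor 2 then offsets the length of the interval. *)
  assert (HI : is_RInt (fun x => 2 * sqrt a * csqrt_im (a - p x) (b - q x) - (b - q x))
    (-1) 1 (2 * sqrt a * 0 - (2 * b - RInt q (-1) 1))).
  { apply (is_RInt_minus (V := R_NormedModule)); [| exact HIbq].
    apply (is_RInt_scal (V := R_NormedModule)).
    rewrite <- H0.
    now apply (RInt_correct (V := R_CompleteNormedModule)), ex_RInt_root_im. }
  assert (Hbound := abs_RInt_le_const _ (-1) 1 (4 * M * (M + M * M) / a)
    ltac:(lra) (ex_intro _ _ HI)).
  rewrite (is_RInt_unique _ _ _ _ HI) in Hbound.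
  replace (b - / 2 * RInt q (-1) 1)
    with (- (/ 2 * (2 * sqrt a * 0 - (2 * b - RInt q (-1) 1)))) by field.
  rewrite Rabs_Ropp, Rabs_mult, (Rabs_pos_eq (/ 2)) by lra.
  enough (Rabs (2 * sqrt a * 0 - (2 * b - RInt q (-1) 1))
    <= (1 - -1) * (4 * M * (M + M * M) / a)) by lra.
  apply Hbound; intros x Hx.
  assert (HpM' := HpM x Hx); assert (HqM' := HqM x Hx).
  assert (Hpb := proj1 (Rabs_le_between _ _) HpM').
  apply csqrt_im_asymptotic; try lra.
  - replace (a - (a - p x)) with (p x) by ring; exact HpM'.
  - apply Rle_trans with (1 := Rabs_triang b (- q x)); rewrite Rabs_Ropp; lra.
Qed.

End Equation.

(** * Existence, uniqueness and expansion of b(a) *)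

Theorem theorem4 (V : C -> C) (D : C -> Prop) (Y : R -> C)
  (HD : complex_domain D)
  (HDI : forall x : R, -1 <= x <= 1 -> D (RtoC x))
  (HV : holomorphic_on D V)
  (H1 : hypH1 V D)
  (H2 : hypH2 V D)
  (HY : primitive_on_segment (-1) 1 V Y) :
  exists (a0 : R) (b : R -> R),
    (forall a : R, a0 <= a ->
       solves V a (b a) /\ forall b' : R, solves V a b' -> b' = b a) /\
    (exists K : R,
       Rbar_locally p_infty
         (fun a : R =>
            Rabs (b a - / 2 * Im (Y 1 - Y (-1))%C) <= K * Rabs (1 / a))).
Proof.
  assert (Hle : -1 <= 1) by lra.
  assert (HVc := holomorphic_continuous_on_segment D V (-1) 1 HV HDI).
  set (p := fun x => Re (V (RtoC (clamp (-1) 1 x)))).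
  set (q := fun x => Im (V (RtoC (clamp (-1) 1 x)))).
  assert (Hp : forall x, continuous p x).
  { apply (continuous_on_clamp (-1) 1 (fun x => Re (V (RtoC x))) Hle).
    apply (continuous_on_comp _ _ Re HVc), continuous_Re. }
  assert (Hq : forall x, continuous q x).
  { apply (continuous_on_clamp (-1) 1 (fun x => Im (V (RtoC x))) Hle).
    apply (continuous_on_comp _ _ Im HVc), continuous_Im. }
  assert (Hpq : forall x, segment (-1) 1 x -> V (RtoC x) = (p x, q x)).
  { intros x Hx; unfold p, q; rewrite clamp_id by exact Hx; apply surjective_pairing. }
  destruct (continuous_bounded_on_segment (-1) 1 p Hle Hp) as [Mp [HMp HpM]].
  destruct (continuous_bounded_on_segment (-1) 1 q Hle Hq) as [Mq [HMq HqM]].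
  set (M := Mp + Mq).
  assert (HM : 0 <= M) by (unfold M; lra).
  assert (HpM' : forall x, segment (-1) 1 x -> Rabs (p x) <= M)
    by (intros x Hx; generalize (HpM x Hx); unfold M; lra).
  assert (HqM' : forall x, segment (-1) 1 x -> Rabs (q x) <= M)
    by (intros x Hx; generalize (HqM x Hx); unfold M; lra).
  assert (HqY : RInt q (-1) 1 = Im (Y 1 - Y (-1))%C).
  { apply (RInt_Im_primitive (-1) 1 V Y q Hle Hq); [| exact HY].
    intros x Hx; now rewrite Hpq. }
  (* Choice makes the zero a function of [a]; below the threshold the value is 0 by default. *)
  destruct (functional_choice (fun a b => 2 * M + 1 <= a ->
    Rabs b <= M /\ root_im_integral p q a b = 0)) as [b Hb].
  { intros a; destruct (Rle_dec (2 * M + 1) a) as [Ha | Ha].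
    - destruct (root_im_integral_zero p q M Hp Hq HM HpM' HqM' a Ha) as [b Hb].
      now exists b.
    - now exists 0. }
  exists (2 * M + 1), b; split.
  - intros a Ha; destruct (Hb a Ha) as [_ H0].
    split; [now apply (solves_iff V p q M) |].
    intros b' Hb'; apply (solves_iff V p q M) in Hb'; try assumption.
    (* A strictly increasing function has at most one zero. *)
    destruct (Rtotal_order b' (b a)) as [Hlt | [Heq | Hgt]]; [exfalso | exact Heq | exfalso].
    + generalize (root_im_integral_increasing p q M Hp Hq HpM' a _ _ Ha Hlt); lra.
    + generalize (root_im_integral_increasing p q M Hp Hq HpM' a _ _ Ha Hgt); lra.
  - exists (4 * M * (M + M * M)), (2 * M + 1); intros a Ha.
    destruct (Hb a (Rlt_le _ _ Ha)) as [HbM H0].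
    rewrite <- HqY, (Rabs_pos_eq (1 / a)).
    + replace (4 * M * (M + M * M) * (1 / a)) with (4 * M * (M + M * M) / a)
        by (field; lra).
      apply (root_im_integral_zero_asymptotic p q M); try assumption; lra.
    + apply Rlt_le, Rdiv_lt_0_compat; lra.
Qed.
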